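(* Let $m,n\ge 2$. For every unitarily invariant norm $\|\cdot\|$ on $\mathbb{M}_n$ and all $A_1,\dots,A_m\in\mathbb{M}_n$, $$\Bigl\| \sum_{k=1}^m A_k \Bigr\|\ \le\ \sqrt2\,\Bigl\| \sum_{k=1}^m |A_k|_{\mathrm{qsym}} \Bigr\|.$$ Moreover, the constant $\sqrt2$ is sharp: if $c$ is a real number such that $\|\sum_{k=1}^m A_k\|\le c\,\|\sum_{k=1}^m|A_k|_{\mathrm{qsym}}\|$ for every unitarily invariant norm on $\mathbb{M}_n$ and all $A_1,\dots,A_m\in\mathbb{M}_n$, then $c\ge \sqrt2$.
   Context: $\mathbb{M}_n$ is the set of $n\times n$ complex matrices, $Z^*$ is the conjugate transpose of $Z$, $|Z|:=(Z^*Z)^{1/2}$, and the quadratic symmetric modulus is $|Z|_{\mathrm{qsym}}:=\left(\frac{|Z|^2+|Z^*|^2}{2}\right)^{1/2}$. A norm $\|\cdot\|$ on $\mathbb{M}_n$ is unitarily invariant if $\|UZV\|=\|Z\|$ for all $Z\in\mathbb{M}_n$ and all unitaries $U,V\in\mathbb{M}_n$. *)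

(* Defs.v *)
From mathcomp Require Import all_boot all_order all_algebra.
From mathcomp Require Import reals complex.

Set Implicit Arguments.
Unset Strict Implicit.
Unset Printing Implicit Defensive.

Import Order.TTheory GRing.Theory Num.Theory.

Local Open Scope ring_scope.
Local Open Scope sesquilinear_scope.

Section Modulus.
Variables (C : numClosedFieldType) (n : nat).
Implicit Types A S T Z : 'M[C]_n.

Definition psdmx A : Prop :=
  A \is hermsymmx /\ forall v : 'rV[C]_n, 0 <= (v *m A *m v ^t* ) 0 0.

(* Spectral calculus: A = P^-1 diag(d) P is sent to P^-1 diag(sqrt d) P with P
   unitary. It is the square root of A only when A is positive semidefinite;
   see psdmx_sqrt, sqrmx_sqrt and psdmx_sqrt_unique. *)
Definition sqrtmx A : 'M[C]_n :=
  invmx (spectralmx A) *m diag_mx (map_mx sqrtC (spectral_diag A))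
    *m spectralmx A.

Definition absmx Z : 'M[C]_n := sqrtmx (Z ^t* *m Z).

Definition qsymmx Z : 'M[C]_n :=
  sqrtmx (2^-1 *: (absmx Z ^+ 2 + absmx (Z ^t* ) ^+ 2)).

Lemma psdmx_gram m (B : 'M[C]_(m, n)) : psdmx (B ^t* *m B).
Proof.
split.
  by apply/is_hermitianmxP; rewrite expr0 scale1r trmx_mul map_mxM /= trmxCK.
move=> v; rewrite mulmxA -mulmxA.
have -> : B *m v ^t* = (v *m B ^t* ) ^t* by rewrite trmx_mul map_mxM /= trmxCK.
rewrite mxE sumr_ge0 // => i _; rewrite !mxE; exact: mul_conjC_ge0.
Qed.

Lemma psdmx_adj A : psdmx A -> A ^t* = A.
Proof. by case=> /is_hermitianmxP + _; rewrite expr0 scale1r => <-. Qed.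

Lemma psdmxD A S : psdmx A -> psdmx S -> psdmx (A + S).
Proof.
move=> psdA psdS; split.
  apply/is_hermitianmxP; rewrite expr0 scale1r linearD /= map_mxD /=.
  by rewrite !psdmx_adj.
by move=> v; rewrite mulmxDr mulmxDl mxE addr_ge0 ?psdA.2 ?psdS.2.
Qed.

Lemma psdmxZ (a : C) A : 0 <= a -> psdmx A -> psdmx (a *: A).
Proof.
move=> a0 psdA; split.
  apply/is_hermitianmxP; rewrite expr0 scale1r linearZ /= map_mxZ /=.
  by rewrite (CrealP (ger0_real a0)) psdmx_adj.
by move=> v; rewrite -scalemxAr -scalemxAl mxE mulr_ge0 ?psdA.2.
Qed.

Lemma psdmx_spectralE A : psdmx A ->
  A = invmx (spectralmx A) *m diag_mx (spectral_diag A) *m spectralmx A.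
Proof. by case=> /hermitian_normalmx /orthomx_spectralP. Qed.

Lemma psdmx_spectral_ge0 A i : psdmx A -> 0 <= spectral_diag A 0 i.
Proof.
move=> psdA; have [_ /(_ (row i (spectralmx A)))] := psdA.
have Pu := spectral_unitarymx A; have Pn := spectral_unit A.
have -> : row i (spectralmx A) *m A *m (row i (spectralmx A)) ^t* =
    row i (diag_mx (spectral_diag A)) *m delta_mx i 0.
  rewrite rowE [in RHS]rowE.
  rewrite [in X in _ *m X *m _](psdmx_spectralE psdA).
  rewrite trmx_mul map_mxM trmx_delta map_delta_mx /=.
  rewrite -invmx_unitary // !mulmxA mulmxK // -mulmxA.
  by rewrite -[_ *m spectralmx A *m invmx _]mulmxA mulmxV // mulmx1 -!mulmxA.
by rewrite -colE !mxE eqxx mulr1n.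
Qed.

Lemma psdmx_sqrt A : psdmx A -> psdmx (sqrtmx A).
Proof.
move=> psdA; rewrite /sqrtmx.
set P := spectralmx A; set s := map_mx sqrtC _.
pose r := map_mx sqrtC s.
have s0 i : 0 <= s 0 i by rewrite mxE sqrtC_ge0 psdmx_spectral_ge0.
suff -> : invmx P *m diag_mx s *m P = (diag_mx r *m P) ^t* *m (diag_mx r *m P).
  exact: psdmx_gram.
rewrite trmx_mul map_mxM /= tr_diag_mx map_diag_mx.
rewrite invmx_unitary ?spectral_unitarymx // !mulmxA; congr (_ *m _).
rewrite -!mulmxA mulmx_diag; congr (_ *m diag_mx _).
apply/rowP => i.
have r0 : 0 <= r 0 i by rewrite mxE sqrtC_ge0.
have -> : s 0 i = r 0 i ^+ 2 by rewrite [r 0 i]mxE sqrtCK.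
by rewrite [RHS]mxE [X in X * _]mxE /= (CrealP (ger0_real r0)) expr2.
Qed.

Lemma sqrmx_sqrt A : psdmx A -> sqrtmx A ^+ 2 = A.
Proof.
move=> psdA; rewrite [RHS]psdmx_spectralE // /sqrtmx expr2.
rewrite -[LHS]/(_ *m _) !mulmxA mulmxK ?spectral_unit //; congr (_ *m _).
rewrite -!mulmxA mulmx_diag; congr (_ *m diag_mx _).
by apply/rowP => i; rewrite !mxE -expr2 sqrtCK.
Qed.

Lemma psdmx_sqr_inj S T : psdmx S -> psdmx T -> S ^+ 2 = T ^+ 2 -> S = T.
Proof.
move=> psdS psdT.
have ES := psdmx_spectralE psdS; have ET := psdmx_spectralE psdT.
have s0 i := psdmx_spectral_ge0 i psdS; have t0 i := psdmx_spectral_ge0 i psdT.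
have Pn := spectral_unit S; have Qn := spectral_unit T.
move: (spectralmx S) (spectral_diag S) (spectralmx T) (spectral_diag T)
  ES ET s0 t0 Pn Qn => P s Q t -> -> s0 t0 Pn Qn.
rewrite !expr2 -[LHS]/(_ *m _) -[RHS]/(_ *m _) !mulmxA !mulmxK //.
move=> /(congr1 (fun X => P *m X *m invmx Q)).
rewrite !mulmxA !mulmxV // !mul1mx mulmxK //.
set W := P *m invmx Q => E.
have {}E : diag_mx s *m W = W *m diag_mx t.
  apply/matrixP => i j.
  move: E; rewrite -[_ *m P *m invmx Q]mulmxA -/W -[LHS]mulmxA.
  move: (W) => V /matrixP/(_ i j).
  rewrite !mul_diag_mx !mul_mx_diag !mxE => E.
  have [->|Wn0] := eqVneq (V i j) 0; first by rewrite mulr0 mul0r.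
  rewrite mulrC; congr (_ * _).
  apply/eqP; rewrite -(eqrXn2 (n := 2)) //; apply/eqP/(mulfI Wn0).
  by rewrite mulrC !expr2 -mulrA E mulrA.
have : invmx P *m (diag_mx s *m W) *m Q = invmx P *m (W *m diag_mx t) *m Q.
  by rewrite E.
by rewrite /W !mulmxA mulmxKV // mulVmx // mul1mx.
Qed.

Lemma psdmx_sqrt_unique A S : psdmx S -> S ^+ 2 = A -> S = sqrtmx A.
Proof.
move=> psdS SA; have psdA : psdmx A.
  rewrite -SA expr2 -[_ * _]/(_ *m _).
  by rewrite -{1}(psdmx_adj psdS); exact: psdmx_gram.
by apply: psdmx_sqr_inj; rewrite ?sqrmx_sqrt //; exact: psdmx_sqrt.
Qed.

Lemma psdmx_abs Z : psdmx (absmx Z).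
Proof. exact/psdmx_sqrt/psdmx_gram. Qed.

Lemma sqrmx_abs Z : absmx Z ^+ 2 = Z ^t* *m Z.
Proof. exact/sqrmx_sqrt/psdmx_gram. Qed.

Lemma psdmx_qsym_arg Z :
  psdmx (2^-1 *: (absmx Z ^+ 2 + absmx (Z ^t* ) ^+ 2)).
Proof.
by apply: psdmxZ; rewrite ?invr_ge0 // !sqrmx_abs; apply: psdmxD;
  exact: psdmx_gram.
Qed.

Lemma psdmx_qsym Z : psdmx (qsymmx Z).
Proof. exact/psdmx_sqrt/psdmx_qsym_arg. Qed.

Lemma sqrmx_qsym Z :
  qsymmx Z ^+ 2 = 2^-1 *: (absmx Z ^+ 2 + absmx (Z ^t* ) ^+ 2).
Proof. exact/sqrmx_sqrt/psdmx_qsym_arg. Qed.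

End Modulus.

Section MatrixNorm.
Variables (R : realType) (n : nat).

Record mx_norm_on (N : 'M[R[i]]_n -> R) : Prop := MxNormOn {
  mx_norm_ge0 : forall A, 0 <= N A;
  mx_norm_eq0 : forall A, N A = 0 -> A = 0;
  mx_normD : forall A B, N (A + B) <= N A + N B;
  mx_normZ : forall (a : R[i]) A, N (a *: A) = Normc.normc a * N A }.

Definition unitarily_invariant (N : 'M[R[i]]_n -> R) : Prop :=
  forall Z U V : 'M[R[i]]_n, U \is unitarymx -> V \is unitarymx ->
    N (U *m Z *m V) = N Z.

End MatrixNorm.

(* Main.v *)
Require Import Defs.
From mathcomp Require Import all_boot all_order all_algebra.
From mathcomp Require classical_sets.
From mathcomp Require Import reals complex.
From mathcomp Require Import ring.

Set Implicit Arguments.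
Unset Strict Implicit.
Unset Printing Implicit Defensive.

Import Order.TTheory GRing.Theory Num.Theory.

Local Open Scope ring_scope.
Local Open Scope sesquilinear_scope.

(** Upper bound. Write [Q] for [qsymmx A], so that [2 Q^2 = |A|^2 + |A^*|^2].
    This dominates both [|A|^2] and [|A^*|^2], and the square root is operator
    monotone ([sqrt_monotone]); hence [|A|] and [|A^*|] are both at most
    [sqrt 2 Q]. The mixed Schwarz inequality, read off a singular value
    decomposition of [A] ([mixed_schwarz]), then gives
      [2 |x A y^*| <= sqrt 2 (x Q x^* + y Q y^* )]
    for all row vectors [x], [y] ([qsym_schwarz]). This is the positivity of the
    block matrix with diagonal blocks [sqrt 2 Q] and off-diagonal blocks [A] and
    [A^*], tested on vectors and minimised over the phases of [x] and [y]. Unlike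
    an inequality between moduli, it can be summed over [k].

    It remains to see that [2 |x S y^*| <= x T x^* + y T y^*] for all [x], [y]
    implies [N S <= N T] ([norm_le_of_form]). If [S = P^* diag(s) V] with [P], [V]
    unitary, taking for [x], [y] the i-th rows of [P], [V] bounds [s_i] by the
    mean of the i-th diagonal entries of [P T P^*] and [V T V^*]. An invariant
    norm is monotone on nonnegative diagonal matrices ([norm_diag_monotone]) and
    does not increase when off-diagonal entries are deleted ([norm_diag_le]): in
    both cases the smaller matrix is obtained from the larger one by means of two
    unitary transforms ([norm_unitary_mean]).

    Sharpness. Let one of the matrices be [E_01] and the others zero. The
    operator norm of [E_01] is 1, while [qsymmx E_01] is
    [(E_00 + E_11) / sqrt 2], of operator norm [1 / sqrt 2]. The operator norm is
    taken here in the form of the supremum of the moduli of the corner entries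
    [(U A V)_00] over unitary [U], [V] ([corner_norm]), from which unitary
    invariance is immediate. *)

(** * Adjoints and unitary matrices *)

Section Unitary.
Variables (C : numClosedFieldType).

Lemma adjmxM m n p (A : 'M[C]_(m, n)) (B : 'M[C]_(n, p)) :
  (A *m B) ^t* = B ^t* *m A ^t*.
Proof. by rewrite trmx_mul map_mxM. Qed.

Lemma adj_diag_mx n (d : 'rV[C]_n) : (forall i, 0 <= d 0 i) ->
  (diag_mx d) ^t* = diag_mx d.
Proof.
move=> d0; rewrite tr_diag_mx map_diag_mx; congr diag_mx.
by apply/rowP => i; rewrite mxE; apply/CrealP/ger0_real.
Qed.

Lemma mulmx_adj_ge0 m n (A : 'M[C]_(m, n)) i : 0 <= (A *m A ^t*) i i.
Proof. by rewrite mxE sumr_ge0 // => k _; rewrite !mxE mul_conjC_ge0. Qed.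

Lemma mulmx_adj_eq0 m n (A : 'M[C]_(m, n)) i :
  (A *m A ^t*) i i = 0 -> row i A = 0.
Proof.
rewrite mxE => /eqP; rewrite psumr_eq0 => [/allP h|k _]; last first.
  by rewrite !mxE mul_conjC_ge0.
apply/rowP => k; rewrite !mxE.
have := h k (mem_index_enum _); rewrite !mxE mulf_eq0 conjC_eq0 orbb.
by move/eqP.
Qed.

Lemma scale_mxK (F : fieldType) m n (a : F) (A : 'M[F]_(m, n)) :
  a != 0 -> a^-1 *: (a *: A) = A.
Proof. by move=> a0; rewrite scalerA mulVf // scale1r. Qed.

Lemma unitarymx1 n : (1%:M : 'M[C]_n) \is unitarymx.
Proof. by apply/unitarymxP; rewrite trmx1 map_mx1 mulmx1. Qed.

Lemma unitary_diag_mx n (d : 'rV[C]_n) :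
  (forall i, d 0 i * (d 0 i)^* = 1) -> diag_mx d \is unitarymx.
Proof.
move=> d1; apply/unitarymxP.
rewrite tr_diag_mx map_diag_mx mulmx_diag -diag_const_mx; congr diag_mx.
by apply/rowP => i; rewrite !mxE d1.
Qed.

Lemma unitary_tperm_mx n (i j : 'I_n) : (tperm_mx i j : 'M[C]_n) \is unitarymx.
Proof.
apply/unitarymxP; rewrite tr_perm_mx map_perm_mx -perm_mxM.
by rewrite perm.tpermV perm.tperm2 perm_mx1.
Qed.

Lemma adj_unitary n (U : 'M[C]_n) :
  U \is unitarymx -> U ^t* \is unitarymx.
Proof. by rewrite trmxC_unitary. Qed.

Lemma unitary_mulK n (A U V : 'M[C]_n) :
  U \is unitarymx -> V \is unitarymx ->
  U ^t* *m (U *m A *m V) *m V ^t* = A.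
Proof.
move=> Uu Vu; rewrite !mulmxA mulmxtVK // -invmx_unitary //.
by rewrite mulVmx ?mul1mx // unitarymx_unit.
Qed.

Lemma unitary_row_norm n (U : 'M[C]_n) i :
  U \is unitarymx -> \sum_j `|U i j| ^+ 2 = 1.
Proof.
move/unitarymxP/matrixP/(_ i i); rewrite !mxE eqxx mulr1n => <-.
by apply: eq_bigr => j _; rewrite !mxE normCK.
Qed.

End Unitary.

(** * Singular value decomposition *)

Section SingularValues.
Variables (C : numClosedFieldType).

(** Orthogonal rows can be scaled to orthonormal ones only when none of them
    is zero. The zero rows are replaced by new rows orthogonal to all the others,
    and the diagonal factor [e] erases them again. *)
Lemma fill_orthogonal_rows n (B : 'M[C]_n) (d : 'rV[C]_n) :
  B *m B ^t* = diag_mx d ->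
  exists (B' : 'M[C]_n) (d' : 'rV[C]_n),
  [/\ forall i, 0 < d' 0 i, B' *m B' ^t* = diag_mx d'
    & exists e : 'rV[C]_n, (forall i, 0 <= e 0 i) /\ B = diag_mx e *m B'].
Proof.
have [k] := ubnP #|[set i | d 0 i == 0]|; elim: k B d => // k IHk B d.
rewrite ltnS => le_k Bd.
have d_ge0 i : 0 <= d 0 i.
  by have := mulmx_adj_ge0 B i; rewrite Bd mxE eqxx mulr1n.
case: (set_0Vmem [set i | d 0 i == 0]) => [z0 | [i ]].
  exists B, d; split=> // [i|].
    rewrite lt_def d_ge0 andbT; apply/negP => di.
    by have := in_set0 i; rewrite -z0 inE di.
  exists (const_mx 1); split=> [i|]; first by rewrite mxE ler01.
  by rewrite diag_const_mx mul1mx.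
(* A zero row leaves room for a nonzero [v] orthogonal to all rows; putting
   [v] in its place keeps the rows orthogonal and leaves fewer zero rows. *)
rewrite inE => /eqP di0.
have Bi0 : row i B = 0 by apply: mulmx_adj_eq0; rewrite Bd mxE eqxx di0.
have /rowV0Pn[v /sub_kermxP vB v0] : kermx (B ^t*) != 0.
  rewrite -mxrank_eq0 mxrank_ker mxrank_map mxrank_tr subn_eq0 -ltnNge.
  rewrite ltn_neqAle rank_leq_row andbT; apply/eqP => Bfree.
  have /row_freeP[M /(congr1 (row i))] : row_free B by apply/eqP.
  rewrite row_mul Bi0 mul0mx => /rowP/(_ i); rewrite !mxE eqxx => /esym/eqP.
  by rewrite oner_eq0.
have Bv : B *m v ^t* = 0.
  by rewrite -[B]trmxCK -adjmxM vB trmx0 map_mx0.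
pose b := (v *m v ^t*) 0 0.
have b_gt0 : 0 < b.
  rewrite lt_def mulmx_adj_ge0 andbT; apply: contraNneq v0 => /mulmx_adj_eq0.
  by rewrite row_id => ->.
pose B1 : 'M[C]_n := B + delta_mx i (0 : 'I_1) *m v.
pose d1 : 'rV[C]_n := d + b *: delta_mx 0 i.
have B1d : B1 *m B1 ^t* = diag_mx d1.
  rewrite /B1 linearD /= map_mxD /= adjmxM mulmxDl !mulmxDr Bd !mulmxA Bv.
  rewrite -[_ *m v *m B ^t*]mulmxA vB mulmx0 mul0mx addr0 add0r.
  rewrite -[_ *m v *m v ^t*]mulmxA [v *m _]mx11_scalar -/b mul_mx_scalar.
  rewrite -scalemxAl trmx_delta map_delta_mx mul_delta_mx linearD linearZ /=.
  congr (_ + _ *: _); apply/matrixP => j l; rewrite !mxE eqxx /=.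
  by rewrite eq_sym; case: (eqVneq i j) => [->|_]; rewrite ?mul0rn // eq_sym.
have card1 : (#|[set j | d1 0%R j == 0%R]| < k)%N.
  apply: leq_trans le_k; apply: proper_card; apply/properP; split.
    apply/subsetP => j; rewrite !inE !mxE eqxx /=.
    case: (eqVneq j i) => [->|_]; first by rewrite di0.
    by rewrite mulr0 addr0.
  exists i; rewrite !inE ?di0 // !mxE !eqxx mulr1 di0 add0r.
  by rewrite gt_eqF.
have [B' [d' [d'0 B'd [e [e0 B1e]]]]] := IHk _ _ card1 B1d.
exists B', d'; split=> //.
exists (\row_j if j == i then 0 else e 0 j); split=> [j|].
  by rewrite mxE; case: ifP.
apply/matrixP => j l; rewrite mul_diag_mx !mxE.
case: (eqVneq j i) => [->|ji].
  by have /rowP/(_ l) := Bi0; rewrite !mxE mul0r.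
have /matrixP/(_ j l) := B1e; rewrite mul_diag_mx !mxE big_ord1 !mxE.
by rewrite (negPf ji) mul0r addr0.
Qed.

(** The unitary [P] diagonalises [A A^*], so the rows of [P A] are orthogonal;
    once the zero ones are replaced, scaling gives [V]. *)
Lemma singular_value_decomposition n (A : 'M[C]_n) :
  exists P V : 'M[C]_n, exists s : 'rV[C]_n,
  [/\ P \is unitarymx, V \is unitarymx, forall i, 0 <= s 0 i
    & A = P ^t* *m diag_mx s *m V].
Proof.
have /psdmx_spectralE E : psdmx (A *m A ^t*).
  by rewrite -{1}[A]trmxCK; apply: psdmx_gram.
set P := spectralmx _ in E; set d := spectral_diag _ in E.
have Pu : P \is unitarymx := spectral_unitarymx _.
have [|B [d' [d'0 Bd [e [e0 PA]]]]] := @fill_orthogonal_rows n (P *m A) d.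
  rewrite adjmxM mulmxA -[P *m A *m _]mulmxA E invmx_unitary // !mulmxA.
  by rewrite mulmxtVK // (unitarymxP Pu) mul1mx.
pose r : 'rV[C]_n := map_mx sqrtC d'.
have r0 i : 0 < r 0 i by rewrite mxE sqrtC_gt0.
pose r1 : 'rV[C]_n := map_mx (fun x => x^-1) r.
have r10 i : 0 <= r1 0 i by rewrite mxE invr_ge0 ltW.
have rr1 : diag_mx r *m diag_mx r1 = 1%:M.
  rewrite mulmx_diag -diag_const_mx; congr diag_mx; apply/rowP => i.
  by rewrite !mxE divff // gt_eqF // sqrtC_gt0.
exists P, (diag_mx r1 *m B), (\row_i (e 0 i * r 0 i)); split=> //.
- apply/unitarymxP; rewrite adjmxM adj_diag_mx // mulmxA.
  rewrite -[_ *m B *m _]mulmxA Bd !mulmx_diag -diag_const_mx; congr diag_mx.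
  apply/rowP => i; rewrite !mxE -[X in _ * X * _]sqrtCK expr2.
  by rewrite mulKf ?divff // gt_eqF // sqrtC_gt0.
- by move=> i; rewrite mxE mulr_ge0 // ltW.
rewrite -mulmx_diag !mulmxA -[_ *m diag_mx r *m _]mulmxA rr1 mulmx1 -mulmxA.
by rewrite -PA mulmxA -invmx_unitary // mulVmx ?mul1mx // unitarymx_unit.
Qed.

End SingularValues.

(** * Mixed Schwarz inequality *)

Section Forms.
Variables (C : numClosedFieldType) (n : nat).
Implicit Types (A X Y P V : 'M[C]_n) (x y v : 'rV[C]_n).

Definition sform A x y : C := (x *m A *m y ^t* ) 0 0.

Lemma sform_row A P V i j :
  sform A (row i P) (row j V) = (P *m A *m V ^t*) i j.
Proof.
by rewrite /sform -row_mul !mxE; apply: eq_bigr => k _; rewrite !mxE.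
Qed.

Lemma sform_sum I (r : seq I) (F : I -> 'M[C]_n) x y :
  sform (\sum_(k <- r) F k) x y = \sum_(k <- r) sform (F k) x y.
Proof. by rewrite /sform mulmx_sumr mulmx_suml summxE. Qed.

Lemma sformD A X x y : sform (A + X) x y = sform A x y + sform X x y.
Proof. by rewrite /sform mulmxDr mulmxDl mxE. Qed.

Lemma sform_decomposition P V (s : 'rV[C]_n) x y :
  sform (P ^t* *m diag_mx s *m V) x y =
    \sum_i (x *m P ^t*) 0 i * s 0 i * ((y *m V ^t*) 0 i)^*.
Proof.
rewrite /sform !mulmxA -[_ *m V *m _]mulmxA.
have -> : V *m y ^t* = (y *m V ^t*) ^t* by rewrite adjmxM trmxCK.
by rewrite mxE; apply: eq_bigr => i _; rewrite mul_mx_diag !mxE.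
Qed.

Lemma psdmx_unitary_diag V (s : 'rV[C]_n) :
  (forall i, 0 <= s 0 i) -> psdmx (V ^t* *m diag_mx s *m V).
Proof.
move=> s0; pose r : 'rV[C]_n := map_mx sqrtC s.
have r0 i : 0 <= r 0 i by rewrite mxE sqrtC_ge0.
suff -> : V ^t* *m diag_mx s *m V = (diag_mx r *m V) ^t* *m (diag_mx r *m V).
  exact: psdmx_gram.
rewrite adjmxM adj_diag_mx // !mulmxA -[_ *m diag_mx r *m diag_mx r]mulmxA.
rewrite mulmx_diag; congr (_ *m diag_mx _ *m _); apply/rowP => i.
by rewrite !mxE -expr2 sqrtCK.
Qed.

Lemma absmx_decomposition P V (s : 'rV[C]_n) :
  P \is unitarymx -> V \is unitarymx -> (forall i, 0 <= s 0 i) ->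
  absmx (P ^t* *m diag_mx s *m V) = V ^t* *m diag_mx s *m V.
Proof.
move=> Pu Vu s0; symmetry; apply: psdmx_sqrt_unique.
  exact: psdmx_unitary_diag.
rewrite !adjmxM trmxCK adj_diag_mx // expr2 -[LHS]/(_ *m _) !mulmxA.
by rewrite !mulmxtVK.
Qed.

(** In the coordinates [u = x P^*], [w = y V^*] of a singular value
    decomposition [A = P^* diag(s) V], this is the inequality
    [2 |u_i| s_i |w_i| <= s_i (|u_i|^2 + |w_i|^2)] summed over [i]. *)
Lemma mixed_schwarz A x y :
  2 * `|sform A x y| <= sform (absmx (A ^t*)) x x + sform (absmx A) y y.
Proof.
have [P [V [s [Pu Vu s0 ->]]]] := singular_value_decomposition A.
rewrite absmx_decomposition // !adjmxM trmxCK adj_diag_mx // mulmxA.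
rewrite absmx_decomposition // !sform_decomposition -big_split /=.
apply: le_trans (ler_wpM2l _ (ler_norm_sum _ _ _)) _ => //.
rewrite mulr_sumr; apply: ler_sum => i _.
move: (_ 0 i) ((y *m _) 0 i) (s 0 i) (s0 i) => u w t t0.
rewrite 2!normrM norm_conjC (ger0_norm t0).
rewrite [u * _]mulrC [w * _]mulrC -!mulrA -!normCK -mulrDr.
have -> : 2 * (`|u| * (t * `|w|)) =
    t * (`|u| ^+ 2 + `|w| ^+ 2) - t * (`|u| - `|w|) ^+ 2.
  by ring.
by rewrite gerBl mulr_ge0 // real_exprn_even_ge0 // realB.
Qed.

(** If [Y - X] had an eigenvalue [l < 0] with unit eigenvector [v], then
    [v X = v Y - l v], and [|v X|^2 = |v Y|^2 - 2 l (v Y v^* ) + l^2] would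
    exceed [|v Y|^2]. *)
Lemma sqrt_monotone X Y : psdmx X -> psdmx Y ->
  (forall v, sform (X ^+ 2) v v <= sform (Y ^+ 2) v v) ->
  forall v, sform X v v <= sform Y v v.
Proof.
move=> pX pY XY; pose H := Y - X.
have adjH : H ^t* = H by rewrite linearB /= map_mxB /= !psdmx_adj.
have hH : H \is hermsymmx by apply/is_hermitianmxP; rewrite expr0 scale1r.
have /orthomx_spectralP := hermitian_normalmx hH.
have /mxOverP dR := hermitian_spectral_diag_real hH.
move: (spectral_unitarymx H) dR.
set P := spectralmx H; set d := spectral_diag H => Pu dR E.
rewrite invmx_unitary // in E.
have d0 i : 0 <= d 0 i.
  case: (real_leP (real0 C) (dR 0 i)) => // di.
  pose v := row i P; set l := d 0 i in di.
  have vH : v *m H = l *: v.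
    rewrite /v -row_mul E !mulmxA (unitarymxP Pu) mul1mx.
    by apply/rowP=> j; rewrite mul_diag_mx !mxE.
  have vv : (v *m v ^t*) 0 0 = 1.
    by have /row_unitarymxP/(_ i i) := Pu; rewrite dotmxE eqxx.
  have vX : v *m X = v *m Y - l *: v.
    by rewrite -vH mulmxBr opprB addrC subrK.
  have sq Z : psdmx Z -> sform (Z ^+ 2) v v = ((v *m Z) *m (v *m Z) ^t*) 0 0.
    by move=> pZ; rewrite /sform adjmxM psdmx_adj // expr2 !mulmxA.
  have := XY v; rewrite !sq // vX.
  have -> : (v *m Y - l *: v) ^t* = (v *m Y) ^t* - l *: v ^t*.
    by rewrite linearB linearZ /= map_mxB map_mxZ /= (CrealP (dR _ _)).
  rewrite mulmxBl !mulmxBr -!scalemxAl -!scalemxAr adjmxM psdmx_adj // !mulmxA.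
  have eB (M N : 'M[C]_1) : (M - N) 0 0 = M 0 0 - N 0 0 by rewrite !mxE.
  have eZ (c : C) (M : 'M[C]_1) : (c *: M) 0 0 = c * M 0 0 by rewrite mxE.
  rewrite !(eB, eZ) vv; have := pY.2 v.
  move: (_ 0 0) => q q0; move: (_ 0 0) => p; rewrite mulr1.
  rewrite -subr_ge0 => h.
  have /lt_geF <- : 0 < l * l - 2 * (l * q).
    rewrite ltr_wpDr ?nmulr_rgt0 // oppr_ge0.
    by rewrite mulr_ge0_le0 // mulr_le0_ge0 // ltW.
  rewrite -subr_ge0; move: h; congr (is_true (_ <= _)); ring.
move=> v; rewrite -subr_ge0.
have -> : sform Y v v - sform X v v = sform H v v.
  by rewrite /sform mulmxBr mulmxBl !mxE.
rewrite E sform_decomposition sumr_ge0 // => i _.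
by rewrite mulrAC mulr_ge0 // mul_conjC_ge0.
Qed.

(** The square of [a *: qsymmx A] is [|A|^2 + |A^*|^2], so this matrix dominates
    both moduli in the mixed Schwarz inequality. *)
Lemma qsym_schwarz (a : C) A x y :
  0 <= a -> a ^+ 2 = 2 ->
  2 * `|sform A x y| <= sform (a *: qsymmx A) x x + sform (a *: qsymmx A) y y.
Proof.
move=> a0 a2.
have sqQ : (a *: qsymmx A) ^+ 2 = absmx A ^+ 2 + absmx (A ^t*) ^+ 2.
  rewrite expr2 -[LHS]/(_ *m _) -scalemxAl -scalemxAr scalerA -[a * a]/(a ^+ 2).
  rewrite a2 -[_ *m _]/(qsymmx A ^+ 2) sqrmx_qsym scalerA.
  by rewrite divff ?scale1r // pnatr_eq0.
have pQ : psdmx (a *: qsymmx A) by apply/psdmxZ/psdmx_qsym.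
have le_abs B : (B = A \/ B = A ^t*) ->
    forall v, sform (absmx B) v v <= sform (a *: qsymmx A) v v.
  move=> BA; apply: sqrt_monotone => // [|v]; first exact: psdmx_abs.
  have pos Z : 0 <= sform (absmx Z ^+ 2) v v.
    by rewrite sqrmx_abs; apply: (psdmx_gram Z).2.
  rewrite sqQ sformD; case: BA => ->; first by rewrite lerDl.
  by rewrite lerDr.
apply: le_trans (mixed_schwarz A x y) _.
by apply: lerD; apply: le_abs; [right|left].
Qed.

End Forms.

(** * Unitarily invariant norms *)

Section InvariantNorm.
Variables (R : realType) (n : nat) (N : 'M[R[i]]_n -> R).
Hypotheses (normN : mx_norm_on N) (invN : unitarily_invariant N).
Implicit Types A S T U V : 'M[R[i]]_n.

Lemma norm_mean A S : N (2^-1 *: (A + S)) <= 2^-1 * (N A + N S).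
Proof.
rewrite mx_normZ // ler_pM ?mx_norm_ge0 ?mx_normD //.
  by rewrite -lecR -[X in _ <= X]/`|2^-1 : R[i]| normr_ge0.
rewrite -lecR -[X in X <= _]/`|2^-1 : R[i]| ger0_norm ?invr_ge0 ?ler0n //.
by rewrite rmorphV ?unitfE ?pnatr_eq0 // rmorph_nat.
Qed.

Lemma norm_unitary_mean A U V U' V' :
  U \is unitarymx -> V \is unitarymx -> U' \is unitarymx -> V' \is unitarymx ->
  N (2^-1 *: (U *m A *m V + U' *m A *m V')) <= N A.
Proof.
move=> *; apply: le_trans (norm_mean _ _) _; rewrite !invN //.
by rewrite -mulr2n -[X in _ * X]mulr_natl mulKf ?pnatr_eq0.
Qed.

(** Off-diagonal entries are deleted one index [k] at a time, because clearing
    those of a single row and column takes only two unitary conjugates. *)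
Definition pinch_from k T : 'M[R[i]]_n :=
  \matrix_(i, j) if (i == j) || (k <= i)%N && (k <= j)%N then T i j else 0.

Lemma norm_pinch_from T k : N (pinch_from k T) <= N T.
Proof.
elim: k => [|k IHk].
  suff -> : pinch_from 0 T = T by [].
  by apply/matrixP => i j; rewrite mxE !leq0n orbT.
apply: le_trans IHk.
(* Averaging with the conjugate by [D] cancels the entries in row and column [k]
   whose sign is changed. *)
pose D : 'M[R[i]]_n := diag_mx (\row_i (-1) ^+ (i == k :> nat)).
have Du : D \is unitarymx.
  apply: unitary_diag_mx => i; rewrite mxE; case: eqP => _.
    by rewrite expr1 rmorphN1 mulrNN mulr1.
  by rewrite expr0 rmorph1 mulr1.
have oneu := unitarymx1 R[i] n.
suff -> : pinch_from k.+1 T =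
    2^-1 *: (1%:M *m pinch_from k T *m 1%:M + D *m pinch_from k T *m D).
  exact: norm_unitary_mean.
rewrite mul1mx mulmx1; apply/matrixP => i j.
rewrite mul_mx_diag mul_diag_mx !mxE.
have half (x : R[i]) : 2^-1 * (x + x) = x.
  by rewrite -mulr2n -[X in _ * X]mulr_natl mulKf ?pnatr_eq0.
case: (eqVneq i j) => [<-|ij] /=.
  by case: eqP => _;
    rewrite ?expr1 ?expr0 ?mulN1r ?mulrN1 ?opprK ?mul1r ?mulr1 half.
case: (ltngtP k i) => ki; case: (ltngtP k j) => kj;
  rewrite /= ?expr0 ?expr1 ?mulN1r ?mulrN1 ?opprK ?mul1r ?mulr1 ?half ?oppr0
    ?addr0 ?subrr ?mulr0 //.
by case/eqP: ij; exact: val_inj (etrans (esym ki) kj).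
Qed.

Lemma norm_diag_le T : N (diag_mx (\row_i T i i)) <= N T.
Proof.
suff <- : pinch_from n T = diag_mx (\row_i T i i) by exact: norm_pinch_from.
apply/matrixP => i j; rewrite !mxE leqNgt ltn_ord /= orbF.
by case: eqVneq => [->|].
Qed.

(** Write [x_i = c_i y_i] with [c_i] in [[0, 1]]. Then [c_i] is the mean of the
    two complex numbers [c_i + i w_i] and [c_i - i w_i] of modulus 1, where
    [w_i = sqrt (1 - c_i^2)]. *)
Lemma norm_diag_monotone (x y : 'rV[R[i]]_n) :
  (forall i, 0 <= x 0 i <= y 0 i) -> N (diag_mx x) <= N (diag_mx y).
Proof.
move=> xy; pose c : 'rV[R[i]]_n := \row_i (x 0 i / y 0 i).
have c01 i : 0 <= c 0 i <= 1.
  case/andP: (xy i) => x0 le_xy; rewrite mxE divr_ge0 //=; last first.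
    exact: le_trans le_xy.
  have [->|y0] := eqVneq (y 0 i) 0; first by rewrite invr0 mulr0.
  by rewrite ler_pdivrMr ?mul1r // lt_def y0 (le_trans x0).
pose w : 'rV[R[i]]_n := \row_i sqrtC (1 - c 0 i ^+ 2).
have wR i : (w 0 i)^* = w 0 i.
  apply/CrealP/ger0_real; rewrite mxE sqrtC_ge0 subr_ge0.
  by case/andP: (c01 i) => *; rewrite exprn_ile1.
have cR i : (c 0 i)^* = c 0 i.
  by apply/CrealP/ger0_real; case/andP: (c01 i).
pose u : 'rV[R[i]]_n := \row_i (c 0 i + 'i%R * w 0 i).
pose v : 'rV[R[i]]_n := \row_i (c 0 i - 'i%R * w 0 i).
have uvE i : (c 0 i + 'i%R * w 0 i) * (c 0 i - 'i%R * w 0 i) = 1.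
  rewrite mulrC -subr_sqr exprMn sqrCi mulN1r opprK [w 0 i]mxE sqrtCK.
  by rewrite addrC subrK.
have uu : diag_mx u \is unitarymx.
  apply: unitary_diag_mx => i; rewrite mxE rmorphD rmorphM /= conjCi cR wR mulNr.
  exact: uvE.
have vu : diag_mx v \is unitarymx.
  apply: unitary_diag_mx => i; rewrite mxE rmorphB rmorphM /= conjCi cR wR.
  by rewrite mulNr opprK mulrC uvE.
have oneu := unitarymx1 R[i] n.
suff -> : diag_mx x = 2^-1 *: (diag_mx u *m diag_mx y *m 1%:M
                               + diag_mx v *m diag_mx y *m 1%:M).
  exact: (norm_unitary_mean _ uu oneu vu oneu).
rewrite !mulmx1 !mulmx_diag -linearD -linearZ; congr diag_mx.
apply/rowP => i; rewrite !mxE -mulrDl addrACA subrr addr0.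
rewrite -mulr2n -[X in _ * (X * _)]mulr_natl -mulrA mulKf ?pnatr_eq0 //.
have [y0|y0] := eqVneq (y 0 i) 0; last by rewrite divfK.
by apply/eqP; move: (xy i); rewrite y0 mulr0 eq_le andbC.
Qed.

(** In a singular value decomposition [S = P^* diag(s) V] the i-th rows of [P] and
    [V] pair to [s_i], so [diag(s)] lies below the mean of the diagonals of two
    unitary conjugates of [T]. *)
Lemma norm_le_of_form S T :
  (forall x y, 2 * `|sform S x y| <= sform T x x + sform T y y) -> N S <= N T.
Proof.
move=> ST; have [P [V [s [Pu Vu s0 SE]]]] := singular_value_decomposition S.
have Vu' : V ^t* \is unitarymx by rewrite trmxC_unitary.
have Pu' : P ^t* \is unitarymx by rewrite trmxC_unitary.
have -> : N S = N (diag_mx s) by rewrite SE (invN _ Pu' Vu).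
have sE i : sform S (row i P) (row i V) = s 0 i.
  rewrite sform_row SE !mulmxA (unitarymxP Pu) mul1mx mulmxtVK //.
  by rewrite mxE eqxx mulr1n.
pose y : 'rV[R[i]]_n := 2^-1 *: (\row_i (P *m T *m P ^t*) i i
                                  + \row_i (V *m T *m V ^t*) i i).
apply: le_trans (_ : N (diag_mx y) <= _).
  apply: norm_diag_monotone => i; rewrite s0 /=.
  rewrite /y 2!mxE [X in X + _]mxE [X in _ + X]mxE -!sform_row.
  rewrite -ler_pdivrMl ?invr_gt0 ?ltr0n // invrK.
  by have := ST (row i P) (row i V); rewrite sE ger0_norm.
rewrite linearZ linearD /=; apply: le_trans (norm_mean _ _) _.
rewrite mulrC ler_pdivrMr ?ltr0n // mulr_natr mulr2n.
have leP := norm_diag_le (P *m T *m P ^t* ); rewrite (invN _ Pu Pu') in leP.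
have leV := norm_diag_le (V *m T *m V ^t* ); rewrite (invN _ Vu Vu') in leV.
exact: (lerD leP leV).
Qed.

End InvariantNorm.

(** * The operator norm *)

(** The entry is the sum of [U_0i d_i V_i0], and [|U_0i| |V_i0|] is at most the
    mean of [|U_0i|^2] and [|V_i0|^2], which both sum to 1. *)
Lemma corner_diag_le (C : numClosedFieldType) n (d : 'rV[C]_n.+1) (h : C)
    (U V : 'M[C]_n.+1) :
  U \is unitarymx -> V \is unitarymx -> (forall i, `|d 0 i| <= h) ->
  `|(U *m diag_mx d *m V) 0 0| <= h.
Proof.
move=> Uu Vu dh; rewrite mxE.
have h0 : 0 <= h by apply: le_trans (dh 0).
have Vn : \sum_i `|V i 0| ^+ 2 = 1.
  rewrite -[RHS](@unitary_row_norm _ _ V^T 0) ?trmx_unitary //.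
  by apply: eq_bigr => i _; rewrite mxE.
apply: le_trans (ler_norm_sum _ _ _) _.
apply: le_trans (_ : \sum_i h * (2^-1 * (`|U 0 i| ^+ 2 + `|V i 0| ^+ 2)) <= _).
  apply: ler_sum => i _; rewrite mul_mx_diag mxE !normrM.
  rewrite [_ * `|d 0 i|]mulrC -mulrA; apply: ler_pM; rewrite ?mulr_ge0 //.
  rewrite -ler_pdivrMl ?invr_gt0 ?ltr0n // invrK mulrA.
  move: (normr_real (U 0 i)) (normr_real (V i 0)).
  move: `|U 0 i| `|V i 0| => u v uR vR.
  have -> : 2 * u * v = u ^+ 2 + v ^+ 2 - (u - v) ^+ 2 by ring.
  by rewrite gerBl real_exprn_even_ge0 // realB.
rewrite -!mulr_sumr big_split /= Vn unitary_row_norm //.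
by rewrite -(natrD _ 1 1) mulVf ?mulr1 // pnatr_eq0.
Qed.

Section CornerNorm.
Variables (R : realType) (n : nat).
Implicit Types A B U V : 'M[R[i]]_n.+1.

Definition corners A : classical_sets.set R := fun r =>
  exists U V, [/\ U \is unitarymx, V \is unitarymx
    & r = Normc.normc ((U *m A *m V) 0 0)].

(** This is the operator norm: the first row of [U] and the first column of [V]
    range over all pairs of unit vectors. *)
Definition corner_norm A : R := sup (corners A).

Lemma normcE_real (z : R[i]) : (Normc.normc z)%:C%C = `|z|.
Proof. by []. Qed.

Lemma normc_ge0 (z : R[i]) : 0 <= Normc.normc z.
Proof. by rewrite -ler0c normcE_real. Qed.

(** A singular value decomposition turns the corners of [A] into those of a
    diagonal matrix, which are bounded by the sum of the singular values. *)
Lemma corners_has_sup A : classical_sets.has_sup (corners A).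
Proof.
have oneu := unitarymx1 R[i] n.+1.
split; first by exists (Normc.normc ((1%:M *m A *m 1%:M) 0 0)), 1%:M, 1%:M.
have [P [Q [s [Pu Qu s0 ->]]]] := singular_value_decomposition A.
exists (Normc.normc (\sum_i s 0 i)) => _ [U [V [Uu Vu ->]]].
rewrite -lecR normcE_real.
have -> : U *m (P ^t* *m diag_mx s *m Q) *m V =
    (U *m P ^t*) *m diag_mx s *m (Q *m V) by rewrite !mulmxA.
have UP := mul_unitarymx Uu (adj_unitary Pu).
apply: (corner_diag_le UP (mul_unitarymx Qu Vu)) => i.
rewrite normcE_real ger0_norm // ger0_norm ?sumr_ge0 //.
by rewrite (bigD1 i) //= lerDl sumr_ge0.
Qed.

Lemma corner_le A U V : U \is unitarymx -> V \is unitarymx ->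
  Normc.normc ((U *m A *m V) 0 0) <= corner_norm A.
Proof.
move=> Uu Vu; apply: ub_le_sup; last by exists U, V.
by have [] := corners_has_sup A.
Qed.

Lemma corner_norm_le A (r : R) :
  (forall U V, U \is unitarymx -> V \is unitarymx ->
    Normc.normc ((U *m A *m V) 0 0) <= r) -> corner_norm A <= r.
Proof.
move=> h; apply: ge_sup; first by have [] := corners_has_sup A.
by move=> _ [U [V [Uu Vu ->]]]; apply: h.
Qed.

Lemma entry_le_corner_norm A i j : Normc.normc (A i j) <= corner_norm A.
Proof.
have -> : A i j = (tperm_mx 0 i *m A *m tperm_mx 0 j) 0 0.
  by rewrite -xrowE -xcolE !mxE !perm.tpermL.
exact: (corner_le _ (unitary_tperm_mx _ _ _) (unitary_tperm_mx _ _ _)).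
Qed.

Lemma corner_norm_norm : mx_norm_on corner_norm.
Proof.
have ge0 A : 0 <= corner_norm A.
  exact: le_trans (normc_ge0 _) (entry_le_corner_norm A 0 0).
have leZ (a : R[i]) A : corner_norm (a *: A) <= Normc.normc a * corner_norm A.
  apply: corner_norm_le => U V Uu Vu.
  rewrite -scalemxAr -scalemxAl mxE Normc.normcM.
  by rewrite ler_wpM2l ?normc_ge0 // corner_le.
split=> // [A A0|A B|a A].
- apply/matrixP => i j; rewrite mxE; apply: Normc.eq0_normc.
  by apply/le_anti; rewrite normc_ge0 -A0 entry_le_corner_norm.
- apply: corner_norm_le => U V Uu Vu.
  rewrite mulmxDr mulmxDl mxE; apply: le_trans (le_normcD _ _) _.
  by rewrite lerD // corner_le.
apply/le_anti; rewrite leZ /=.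
have [->|a0] := eqVneq a 0; first by rewrite Normc.normc0 mul0r.
have na0 : 0 < Normc.normc a.
  by rewrite lt_def normc_ge0 andbT; apply: contraNneq a0 => /Normc.eq0_normc ->.
rewrite -ler_pdivlMl // -Normc.normcV.
have := leZ a^-1 (a *: A).
by rewrite scale_mxK.
Qed.

Lemma corner_norm_invariant : unitarily_invariant corner_norm.
Proof.
have le (A U V : 'M[R[i]]_n.+1) : U \is unitarymx -> V \is unitarymx ->
    corner_norm (U *m A *m V) <= corner_norm A.
  move=> Uu Vu; apply: corner_norm_le => U' V' U'u V'u.
  have -> : U' *m (U *m A *m V) *m V' = (U' *m U) *m A *m (V *m V').
    by rewrite !mulmxA.
  exact: corner_le (mul_unitarymx U'u Uu) (mul_unitarymx Vu V'u).
move=> A U V Uu Vu; apply: le_anti; apply/andP; split; first exact: le.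
have := le (U *m A *m V) _ _ (adj_unitary Uu) (adj_unitary Vu).
by rewrite (unitary_mulK A Uu Vu).
Qed.

End CornerNorm.

(** * The extremal example *)

Lemma qsymmx0 (C : numClosedFieldType) n : qsymmx (0 : 'M[C]_n) = 0.
Proof.
symmetry; apply: psdmx_sqrt_unique.
  by rewrite -(scale0r (1%:M ^t* *m 1%:M)); apply/psdmxZ/psdmx_gram.
by rewrite !sqrmx_abs trmx0 map_mx0 !mulmx0 addr0 scaler0 expr0n.
Qed.

Lemma qsymmx_delta01 (C : numClosedFieldType) n (h : C) :
  0 <= h -> h ^+ 2 = 2^-1 ->
  qsymmx (delta_mx ord0 (lift ord0 ord0) : 'M[C]_n.+2)
    = diag_mx (\row_i (h * (i < 2)%N%:R)).
Proof.
move=> h0 h2; symmetry; apply: psdmx_sqrt_unique.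
  set s := \row_i _.
  have s0 i : 0 <= s 0 i by rewrite mxE mulr_ge0 ?ler0n.
  by have := psdmx_unitary_diag 1%:M s0; rewrite trmx1 map_mx1 mul1mx mulmx1.
rewrite !sqrmx_abs trmxCK trmx_delta map_delta_mx !mul_delta_mx expr2.
rewrite -[LHS]/(_ *m _) mulmx_diag.
apply/matrixP => i j; rewrite !mxE -h2 -!val_eqE /=.
case: i => [[|[|i]] Hi] /=; case: j => [[|[|j]] Hj] /=;
  by rewrite ?mulr1 ?mulr0 ?mul0rn ?mulr1n ?mulr0n ?addr0 ?add0r ?mulr0 ?mulr1.
Qed.

Theorem theorem1p9 (R : realType) (m n : nat) (hm : (2 <= m)%N)
    (hn : (2 <= n)%N) :
  (forall N : 'M[R[i]]_n -> R, mx_norm_on N -> unitarily_invariant N ->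
    forall A : 'I_m -> 'M[R[i]]_n,
      N (\sum_(k < m) A k) <= Num.sqrt 2 * N (\sum_(k < m) qsymmx (A k)))
  /\
  (forall c : R,
    (forall N : 'M[R[i]]_n -> R, mx_norm_on N -> unitarily_invariant N ->
      forall A : 'I_m -> 'M[R[i]]_n,
        N (\sum_(k < m) A k) <= c * N (\sum_(k < m) qsymmx (A k))) ->
    Num.sqrt 2 <= c).
Proof.
have sqrt2_gt0 : 0 < Num.sqrt (2 : R) by rewrite sqrtr_gt0 ltr0n.
pose a : R[i] := (Num.sqrt 2)%:C%C.
have a_gt0 : 0 < a by rewrite ltcR.
have a2 : a ^+ 2 = 2 by rewrite -rmorphXn /= sqr_sqrtr ?ler0n // rmorph_nat.
split=> [N normN invN A|c hc].
  have -> : Num.sqrt 2 * N (\sum_(k < m) qsymmx (A k)) =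
      N (a *: \sum_(k < m) qsymmx (A k)).
    rewrite mx_normZ //; congr (_ * _).
    by apply: complexI; rewrite normcE_real ger0_norm // ltW.
  apply: norm_le_of_form => // x y.
  rewrite scaler_sumr !sform_sum -big_split /=.
  apply: le_trans (ler_wpM2l _ (ler_norm_sum _ _ _)) _ => //.
  rewrite mulr_sumr; apply: ler_sum => k _.
  by apply: qsym_schwarz => //; apply: ltW.
case: n hn hc => [|[|n]] // _; case: m hm => [|m] // _ hc.
pose E : 'M[R[i]]_n.+2 := delta_mx ord0 (lift ord0 ord0).
pose d : 'rV[R[i]]_n.+2 := \row_i (a^-1 * (i < 2)%N%:R).
pose A (k : 'I_m.+1) : 'M[R[i]]_n.+2 := if k == ord0 then E else 0.
have sumA : \sum_(k < m.+1) A k = E.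
  by rewrite big_ord_recl big1 ?addr0.
have a_inv2 : (a^-1) ^+ 2 = 2^-1 by rewrite exprVn a2.
have sumQ : \sum_(k < m.+1) qsymmx (A k) = diag_mx d.
  rewrite big_ord_recl big1 => [|k _]; last exact: qsymmx0.
  by rewrite addr0; apply: qsymmx_delta01 a_inv2; rewrite invr_ge0 ltW.
have := hc _ (@corner_norm_norm R n.+1) (@corner_norm_invariant R n.+1) A.
rewrite sumA sumQ => le_c.
have N1 : 1 <= corner_norm E.
  have := entry_le_corner_norm E ord0 (lift ord0 ord0).
  by rewrite /E mxE !eqxx Normc.normc1.
have NQ : corner_norm (diag_mx d) <= (Num.sqrt 2)^-1.
  apply: corner_norm_le => U V Uu Vu.
  rewrite -lecR normcE_real; apply: (corner_diag_le Uu Vu) => i.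
  rewrite mxE normrM.
  rewrite rmorphV ?unitfE ?gt_eqF // -/a (ger0_norm (ltW _)) ?invr_gt0 //.
  by rewrite ler_piMr ?invr_ge0 ?(ltW a_gt0) // normr_nat lern1 leq_b1.
have NQ0 : 0 <= corner_norm (diag_mx d).
  exact: (mx_norm_ge0 (@corner_norm_norm R n.+1)).
have c0 : 0 <= c.
  rewrite leNgt; apply/negP => /ltW c0.
  have := lt_le_trans ltr01 (le_trans N1 (le_trans le_c (mulr_le0_ge0 c0 NQ0))).
  by rewrite ltxx.
have := le_trans N1 (le_trans le_c (ler_wpM2l c0 NQ)).
by rewrite ler_pdivlMr // mul1r.
Qed.
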